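(* Let $G$ be a finite hamiltonian group. Then $G$ can uniquely be written as the union of three proper subgroups if and only if $G\cong Q_8\times A$ for some finite abelian group $A$ of odd order.
   Context: A hamiltonian group is a nonabelian group all of whose subgroups are normal. $Q_8$ denotes the quaternion group of order $8$. A subgroup $H$ of $G$ is proper if $H\neq G$. ''$G$ can uniquely be written as the union of three proper subgroups'' means that there is exactly one (unordered) set $\{H_1,H_2,H_3\}$ of three proper subgroups of $G$ with $G=H_1\cup H_2\cup H_3$. *)

(* Defs.v *)
From HB Require Import structures.
From mathcomp Require Import all_boot all_fingroup all_solvable.

Set Implicit Arguments.
Unset Strict Implicit.
Unset Printing Implicit Defensive.

Import GroupScope.

Definition hamiltonian (gT : finGroupType) (G : {group gT}) : Prop :=
  ~ abelian G /\ (forall H : {group gT}, H \subset G -> H <| G).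

(* Requiring the three subgroups to be pairwise distinct (#|P| = 3) loses
   nothing: no group is the union of at most two proper subgroups. *)
Definition three_proper_cover (gT : finGroupType) (G : {group gT})
    (P : {set {group gT}}) : Prop :=
  [/\ #|P| = 3,
      (forall H : {group gT}, H \in P -> H \proper G)
    & \bigcup_(H in P) (H : {set gT}) = G].

(* Main.v *)
Require Import Defs.
From HB Require Import structures.
From mathcomp Require Import all_boot all_fingroup all_solvable.

Set Implicit Arguments.
Unset Strict Implicit.
Unset Printing Implicit Defensive.

Import GroupScope.

(* Let I be the set of subgroups of index 2 of G.  By Scorza's counting argument
   all members of a cover by three proper subgroups lie in I, and any two distinct
   A, B in I complete to a cover by T = {g | g in A <-> g in B}.  So the cover is
   unique as soon as |I| <= 3, which holds if G is generated by two elements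
   together with elements of odd order.

   Conversely, a hamiltonian group contains a copy <x, y> of Q_8, and 'C_G[x],
   'C_G[y] have index 2.  If the cover they define is unique, then no subgroup H
   of index 2 contains both x and y, for otherwise 'C_G[x] and H would define
   another one.  But G modulo <x, y> 'O_2^'(G) is a 2-group, hence it is trivial,
   so that G is the direct product of <x, y> and 'O_2^'(G). *)

Lemma cycle4_involution (gT : finGroupType) (u c : gT) :
  #[u] = 4 -> #[c] = 2 -> c \in <[u]> -> u ^+ 2 = c.
Proof.
move=> ou oc /cyclePmin[i lt_i4 ci]; rewrite ou in lt_i4.
have:= oc; rewrite ci orderXgcd ou.
by case: i lt_i4 {ci oc} => [|[|[|[]]]].
Qed.

(** Twice the binomial is [p ^ k.+1 * (p ^ k.+1).-1]. Halving keeps a factor [p] when [p] is odd,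
    and also when [p = 2] and [k > 0]. *)
Lemma dvdn_bin2_expn p k :
  prime p -> ~~ (p %| 'C(p ^ k.+1, 2)) -> p = 2 /\ k = 0.
Proof.
move=> p_pr; have [p2 | p_odd] := even_prime p_pr.
  rewrite {}p2; case: k => // k /negP[].
  by rewrite bin2 expnS -mulnA mul2n doubleK expnS -mulnA dvdn_mulr.
case/negP; rewrite -(@Gauss_dvdr _ 2) ?coprimen2 //.
by rewrite -mul_bin_diag bin1 expnS -mulnA dvdn_mulr.
Qed.

(** * Quaternion generators in a nonabelian Dedekind group *)

Section Dedekind.

Variables (gT : finGroupType) (G : {group gT}).
Hypothesis dedG : forall H : {group gT}, H \subset G -> H <| G.

Lemma dedekind_conj_cycle x g : x \in G -> g \in G -> x ^ g \in <[x]>.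
Proof.
move=> Gx Gg; have /normal_norm/subsetP/(_ g Gg)/normP <- : <[x]> <| G.
  by apply: dedG; rewrite cycle_subG.
by rewrite memJ_conjg cycle_id.
Qed.

Lemma dedekind_comm_cycle x y :
  x \in G -> y \in G -> [~ x, y] \in <[x]> /\ [~ x, y] \in <[y]>.
Proof.
move=> Gx Gy; split; first by rewrite groupMl ?groupV ?cycle_id ?dedekind_conj_cycle.
by rewrite -invg_comm groupV groupMl ?groupV ?cycle_id ?dedekind_conj_cycle.
Qed.

Lemma dedekind_commute_comm x y :
  x \in G -> y \in G -> commute x [~ x, y] /\ commute y [~ x, y].
Proof.
move=> Gx Gy; have [/cycleP[i ci] /cycleP[j cj]] := dedekind_comm_cycle Gx Gy.
by split; [rewrite ci | rewrite cj]; apply: commuteX.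
Qed.

(* For noncommuting x, y with #[x] + #[y] minimal and c = [~ x, y], minimality
   forces #[c] to be a prime p, with x and y p-elements.  If #[y] <= #[x], then
   <[c]> is the socle of both <[x]> and <[y]>, so some power b of x satisfies
   (y * b) ^+ (#[y] %/ p) = [~ b, y] ^+ 'C(#[y] %/ p, 2).  By minimality this is
   not 1, which leaves only p = 2 and #[x] = #[y] = 4. *)
Lemma dedekind_nonabelian_quaternion_gens :
    ~~ abelian G ->
  exists x y, [/\ x \in G, y \in G, #[x] = 4, y ^+ 2 = x ^+ 2 & x ^ y = x^-1].
Proof.
move=> nabG.
pose P := [pred u : gT * gT | [&& u.1 \in G, u.2 \in G & [~ u.1, u.2] != 1]].
have [[x0 y0] P0]: exists u, P u.
  have /subsetPn[x Gx /centP notCx] : ~~ (G \subset 'C(G)) by [].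
  have [/existsP[y /andP[Gy cxy]] | ] :=
    boolP [exists y, (y \in G) && ([~ x, y] != 1)].
    by exists (x, y); apply/and3P.
  move/existsPn=> all1; case: notCx => y Gy; apply/commgP.
  by have:= all1 y; rewrite Gy negbK.
case: (@arg_minnP _ _ P (fun u => #[u.1] + #[u.2])%N P0) => -[x y] /=.
case/and3P=> /= Gx Gy; set c := [~ x, y] => c_neq1 min_xy {x0 y0 P0}.
wlog le_yx: x y Gx Gy @c c_neq1 min_xy / #[y] <= #[x].
  move=> IH; have [le_yx | /ltnW le_xy] := leqP #[y] #[x]; first exact: IH le_yx.
  apply: (IH y x) => //; first by rewrite -invg_comm invg_eq1.
  by move=> u /min_xy; rewrite addnC.
have [[cxc cyc] [xc yc]] :=
  (dedekind_commute_comm Gx Gy, dedekind_comm_cycle Gx Gy).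
rewrite -/c in cxc cyc xc yc.
have minx u : u \in G -> #[u] < #[x] -> [~ u, y] = 1.
  move=> Gu ltux; apply/eqP; apply: contraTT ltux => nc.
  by have:= min_xy (u, y); rewrite /= Gu Gy nc leq_add2r -leqNgt => ->.
have miny u : u \in G -> #[u] < #[y] -> [~ x, u] = 1.
  move=> Gu ltux; apply/eqP; apply: contraTT ltux => nc.
  by have:= min_xy (x, u); rewrite /= Gu Gx nc leq_add2l -leqNgt => ->.
have cX i : [~ x ^+ i, y] = c ^+ i by apply: commXg.
have cY i : [~ x, y ^+ i] = c ^+ i by apply: commgX.
have ltX (u : gT) q : u != 1 -> prime q -> q %| #[u] -> #[u ^+ q] < #[u].
  by move=> u1 q_pr qu; rewrite orderXdiv // ltn_Pdiv ?prime_gt1 ?order_gt1.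
have x_neq1 : x != 1 by apply: contraNneq c_neq1 => x1; rewrite /c x1 comm1g.
have y_neq1 : y != 1 by apply: contraNneq c_neq1 => y1; rewrite /c y1 commg1.
pose p := pdiv #[x]; have p_pr : prime p by rewrite pdiv_prime ?order_gt1.
(* If [q] divides [#[x]], then [x ^+ q] has smaller order, so by minimality it commutes with [y];
   likewise for [y]. *)
have cp q : prime q -> (q %| #[x]) || (q %| #[y]) -> c ^+ q = 1.
  move=> q_pr /orP[] qd; first by rewrite -cX minx ?groupX ?ltX.
  by rewrite -cY miny ?groupX ?ltX.
have oc : #[c] = p.
  by apply: nt_prime_order => //; rewrite cp ?pdiv_dvd.
have eqp q : prime q -> (q %| #[x]) || (q %| #[y]) -> q = p.
  move=> q_pr /(cp q q_pr)/eqP; rewrite -order_dvdn oc.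
  by rewrite dvdn_prime2 // => /eqP.
have [n on] : exists n, #[x] = (p ^ n)%N.
  suff /p_natP[k ok] : p.-nat #[x] by exists k.
  apply/pnatP=> // q q_pr qd.
  by rewrite inE /= (eqp q) ?qd.
have [m om] : exists m, #[y] = (p ^ m)%N.
  suff /p_natP[k ok] : p.-nat #[y] by exists k.
  apply/pnatP=> // q q_pr qd.
  by rewrite inE /= (eqp q) ?qd ?orbT.
(* For [k <= 1] the group [<[u]>] would coincide with [<[c]>]. Neither [x] nor [y] lies in [<[c]>],
   since [c] commutes with both while they do not commute with each other. *)
have gt1 (u : gT) k : #[u] = (p ^ k)%N -> c \in <[u]> ->
    ~~ (<[u]> \subset <[c]>) -> 1 < k.
  move=> ou uc; apply: contraR; rewrite -leqNgt => le_k1.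
  have <- : <[c]> = <[u]>; last by [].
  apply/eqP; rewrite eqEcard cycle_subG uc -!orderE ou oc /=.
  by rewrite -{2}[p]expn1 leq_pexp2l ?prime_gt0.
have n_gt1 : 1 < n.
  apply: gt1 on xc _; apply: contra c_neq1; rewrite cycle_subG.
  by case/cycleP=> i xi; apply/commgP; rewrite xi; apply/commute_sym/commuteX.
have m_gt1 : 1 < m.
  apply: gt1 om yc _; apply: contra c_neq1; rewrite cycle_subG.
  by case/cycleP=> i yi; apply/commgP; rewrite yi; apply/commuteX.
have le_mn : m <= n by move: le_yx; rewrite on om leq_exp2l ?prime_gt1.
have cycc (u : gT) k : #[u] = (p ^ k)%N -> 1 < k -> c \in <[u]> ->
    <[u ^+ (p ^ k.-1)]> = <[c]>.
  move=> ou k_gt1 uc; apply/eqP.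
  rewrite (eq_subG_cyclic (cycle_cyclic u)) ?cycleX ?cycle_subG // -!orderE.
  by rewrite (orderXexp k.-1 ou) -[in X in k - X]subn1 subKn ?(ltnW k_gt1) // expn1 oc.
have /cycleP[j yj] : y ^+ (p ^ m.-1) \in <[x ^+ (p ^ n.-1)]>.
  by rewrite (cycc x n) // -(cycc y m) // cycle_id.
(* Since [n.-1 = (n - m) + m.-1], the element [x ^+ (j * p ^ (n - m))] has the same [p ^ m.-1]-th
   power as [y]. The factor [#[x].-1] inverts it. *)
pose i := (j * p ^ (n - m) * #[x].-1)%N; pose b := x ^+ i.
have bE : y ^+ (p ^ m.-1) * b ^+ (p ^ m.-1) = 1.
  have e : (n - m + m.-1 = n.-1)%N by rewrite -!subn1 addnBA ?subnK // ltnW.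
  rewrite yj -!expgM /i mulnAC -(mulnA j) -expnD e -[X in x ^+ X * _]muln1.
  rewrite (mulnC j) -expgD -mulnDr addnC addn1 prednK ?order_gt0 //.
  by rewrite mulnC expgM expg_order expg1n.
have cb : [~ b, y] = c ^+ i by apply: cX.
have bcb : commute b [~ b, y] by rewrite cb; apply/commuteX2.
have ycb : commute y [~ b, y] by rewrite cb; apply/commuteX.
(* Otherwise [y * b] commutes with [x] by minimality, and so does [y], because [b] is a power of
   [x]. *)
have big : #[y] <= #[y * b].
  apply: contraNleq c_neq1 => lt_yb; apply/commgP.
  have /eqP/commgP xyb := miny (y * b) (groupM Gy (groupX i Gx)) lt_yb.
  by rewrite -(mulgK b y); apply: commuteM => //; apply/commuteV/commuteX.
have : (y * b) ^+ (p ^ m.-1) != 1.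
  apply: contraTneq big => yb1; rewrite -ltnNge.
  apply: (@leq_ltn_trans (p ^ m.-1)).
    by rewrite dvdn_leq ?expn_gt0 ?prime_gt0 // order_dvdn yb1.
  by rewrite om ltn_exp2l ?prime_gt1 // prednK // ltnW.
rewrite expMg_Rmul // bE mul1g cb -expgM -order_dvdn oc Euclid_dvdM // negb_or.
have Dm : m = m.-2.+2 by case: (m) m_gt1 => [|[]].
case/andP=> pi; rewrite {1}Dm => /(dvdn_bin2_expn p_pr)[p2 m2].
rewrite {}m2 in Dm.
(* [i] is prime to [p] but has the factor [p ^ (n - m)], where now [m = 2]. *)
have n2 : n = 2.
  apply/eqP; rewrite eqn_leq n_gt1 andbT leqNgt; apply: contra pi => n_gt2.
  by rewrite /i mulnAC dvdn_mull // dvdn_exp // Dm subn_gt0.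
rewrite p2 n2 in on; rewrite p2 Dm in om; rewrite p2 in oc.
have [x2 y2] := (cycle4_involution on oc xc, cycle4_involution om oc yc).
exists x, y; split=> //; first by rewrite y2 x2.
have x4 : x ^+ 4 = 1 by rewrite -(expg_order x) on.
by rewrite conjg_mulR -/c -x2; apply/eqP; rewrite eq_sym eq_invg_mul -!expgS x4.
Qed.

End Dedekind.

(** * Subgroups of index 2 and covers by three proper subgroups *)

Section Index2.

Variables (gT : finGroupType) (G : {group gT}).

Definition index2_subgroups :=
  [set H : {group gT} | (H \subset G) && (#|G : H| == 2)].

Lemma index2_subgroupsP (H : {group gT}) :
  reflect (H \subset G /\ #|G : H| = 2) (H \in index2_subgroups).
Proof. by rewrite inE; apply: (iffP andP) => -[-> /eqP]. Qed.

(** Membership in [H] acts as a character with values in Z/2. If [g] and [h] both lie outside [H],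
    the coset [H :* h^-1] is all of [G :\: H] and so contains [g]. *)
Lemma index2_memM (H : {group gT}) g h :
    H \in index2_subgroups -> g \in G -> h \in G ->
  (g * h \in H) = ((g \in H) == (h \in H)).
Proof.
case/index2_subgroupsP=> sHG iH Gg Gh.
have [Hg | nHg] := boolP (g \in H); first by rewrite groupMl // eq_sym eqb_id.
have [Hh | nHh] := boolP (h \in H); first by rewrite groupMr // (negbTE nHg).
have dH : H :* h^-1 = G :\: H by apply: rcoset_index2; rewrite // inE !groupV nHh.
have: g \in H :* h^-1 by rewrite dH inE nHg.
by rewrite mem_rcoset invgK.
Qed.

Lemma index2_proper (H : {group gT}) : H \in index2_subgroups -> H \proper G.
Proof.
case/index2_subgroupsP=> sHG iH.
by rewrite properEneq sHG andbT; apply/eqP=> e; rewrite e indexgg in iH.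
Qed.

Lemma index2_sub_eq (A B : {group gT}) :
  A \in index2_subgroups -> B \in index2_subgroups -> A \subset B -> A = B.
Proof.
move=> /index2_subgroupsP[sAG iA] /index2_subgroupsP[sBG iB] sAB.
apply/val_inj/eqP; rewrite eqEcard sAB /= -(@leq_pmul2r 2) //.
by rewrite -{1}iB -iA !Lagrange.
Qed.

(** [T] is the kernel of the product of the two characters with kernels [A] and [B]. An element
    outside both [A] and [B] lies in [T], while an element of [A] outside [B] shows that [T] is
    proper. *)
Lemma index2_third_cover (A B : {group gT}) :
    A \in index2_subgroups -> B \in index2_subgroups -> A != B ->
  exists2 T : {group gT}, T = [set g in G | (g \in A) == (g \in B)] :> {set gT}
    & three_proper_cover G [set A; B; T].
Proof.
move=> iA iB neqAB; set S := [set g in G | _].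
have gS : group_set S.
  apply/group_setP; split; first by rewrite inE !group1 eqxx.
  move=> g h /setIdP[Gg /eqP gE] /setIdP[Gh /eqP hE].
  by rewrite inE groupM //= !index2_memM // gE hE.
have subG C : C \in index2_subgroups -> C \subset G by case/index2_subgroupsP.
have exD (C D : {group gT}) : C \in index2_subgroups -> D \in index2_subgroups ->
    C != D -> exists g, [/\ g \in G, g \in C & g \notin D].
  move=> iC iD neqCD; have /subsetPn[g Cg nDg] : ~~ (C \subset D).
    by apply: contra neqCD => sCD; apply/eqP/index2_sub_eq.
  by exists g; split=> //; apply: subsetP Cg; apply: subG.
have [a [Ga Aa nBa]] := exD _ _ iA iB neqAB.
have [b [Gb Bb nAb]] := exD _ _ iB iA (contra_neq esym neqAB).
exists (Group gS) => //; split.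
- have nTa : a \notin Group gS by rewrite inE Ga Aa (negbTE nBa).
  have nTb : b \notin Group gS by rewrite inE Gb Bb (negbTE nAb).
  have neqAT : A != Group gS by apply: contraNneq nTa => <-.
  have neqBT : B != Group gS by apply: contraNneq nTb => <-.
  by rewrite setUC cardsU1 cards2 !inE neqAB eq_sym (negbTE neqAT) eq_sym (negbTE neqBT).
- move=> H; rewrite !inE -orbA => /or3P[] /eqP-> ; try exact: index2_proper.
  apply/properP; split; first by apply/subsetP=> g /setIdP[].
  by exists a; rewrite // inE Ga Aa (negbTE nBa).
apply/setP=> g; apply/bigcupP/idP => [[H] | Gg].
  rewrite !inE -orbA => /or3P[] /eqP-> /=; try by apply: subsetP; apply: subG.
  by case/setIdP.
have [Ag | nAg] := boolP (g \in A); first by exists A; rewrite ?inE ?eqxx.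
have [Bg | nBg] := boolP (g \in B); first by exists B; rewrite ?inE ?eqxx ?orbT.
by exists (Group gS); rewrite ?inE ?eqxx ?orbT // Gg (negbTE nAg) (negbTE nBg).
Qed.

(** The set [H * K] fits into [G], so [H] occupies at least as large a proportion of [K] as of
    [G]. *)
Lemma card_setD_mul_le (H K : {group gT}) :
  H \subset G -> K \subset G -> (#|K :\: H| * #|G| <= #|K| * (#|G| - #|H|))%N.
Proof.
move=> sHG sKG; rewrite mulnBr leq_subRL ?leq_mul ?subset_leq_card //.
rewrite -[X in _ <= X * _](cardsID H K) mulnDl leq_add2r mul_cardG mulnC leq_mul //.
by rewrite subset_leq_card // mul_subG.
Qed.

(* Counting [G :\: H1] with [card_setD_mul_le] gives [|G| <= |H2| + |H3|]. *)
Lemma scorza_index (H1 H2 H3 : {group gT}) :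
    H1 \proper G -> H2 \proper G -> H3 \proper G ->
    G \subset H1 :|: H2 :|: H3 -> #|G : H2| = 2.
Proof.
move=> pH1 pH2 pH3 cov.
have [sH1 sH2 sH3] := And3 (proper_sub pH1) (proper_sub pH2) (proper_sub pH3).
have dbl (H : {group gT}) : H \proper G -> (#|H| * 2 <= #|G|)%N.
  case/andP=> sH nH; rewrite -(Lagrange sH) leq_pmul2l ?cardG_gt0 //.
  by rewrite indexg_gt1.
have gt0 : (0 < #|G| - #|H1|)%N by rewrite subn_gt0 proper_card.
have le : (#|G| <= #|H2| + #|H3|)%N.
  rewrite -(leq_pmul2r gt0) mulnDl.
  apply: leq_trans (leq_add (card_setD_mul_le sH1 sH2) (card_setD_mul_le sH1 sH3)).
  rewrite -mulnDl mulnC leq_pmul2r ?cardG_gt0 // -{1}(setIidPr sH1) -cardsD.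
  apply: leq_trans (_ : #|(H2 :\: H1) :|: (H3 :\: H1)| <= _)%N.
    apply/subset_leq_card/subsetP=> g /setDP[Gg nH1g]; rewrite !inE nH1g /=.
    by have:= subsetP cov g Gg; rewrite !inE (negbTE nH1g).
  by rewrite cardsU leq_subr.
(* Double [le] and bound [#|H3| * 2] by [#|G|]; what is left is [#|G| <= #|H2| * 2]. *)
have e : (#|H2| * 2 = #|G|)%N.
  apply/eqP; rewrite eqn_leq dbl // -(leq_add2r #|G|).
  apply: (leq_trans (leq_add le le)); rewrite addnACA !addnn -!muln2 leq_add2l.
  exact: dbl.
by apply/eqP; rewrite -(eqn_pmul2l (cardG_gt0 H2)) Lagrange // e.
Qed.

Lemma three_proper_cover_index2 (P : {set {group gT}}) :
  three_proper_cover G P -> P \subset index2_subgroups.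
Proof.
case=> cardP properP covP; apply/subsetP=> H PH.
apply/index2_subgroupsP; split; first exact: proper_sub (properP _ PH).
have /cards2P[K [L [_ DP]]] : #|P :\ H| == 2.
  by have:= cardsD1 H P; rewrite PH cardP add1n => -[<-].
have [/setDP[PK _] /setDP[PL _]] : K \in P :\ H /\ L \in P :\ H.
  by rewrite DP !inE !eqxx orbT.
apply: (@scorza_index K H L); try exact: properP.
rewrite -covP; apply/bigcupsP=> M PM.
have: M \in H |: (P :\ H) by rewrite setD1K.
rewrite DP !inE => /or3P[] /eqP->; rewrite ?subsetUr //.
  by rewrite (setUC K) -setUA subsetUl.
by rewrite -setUA subsetUl.
Qed.

Lemma three_proper_cover_unique :
    (exists P, three_proper_cover G P) -> #|index2_subgroups| <= 3 ->
  exists! P, three_proper_cover G P.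
Proof.
move=> [P covP] le3.
have coverE R : three_proper_cover G R -> R = index2_subgroups.
  move=> covR; apply/eqP; rewrite eqEcard three_proper_cover_index2 //=.
  by case: covR => ->.
by exists P; split=> // R /coverE->; apply: coverE.
Qed.

(** An element of odd order is a square, and squares lie in every subgroup of index 2. *)
Lemma index2_odd_elt (H : {group gT}) d :
  H \in index2_subgroups -> d \in G -> odd #[d] -> d \in H.
Proof.
move=> iH Gd od; have -> : d = d ^+ (#[d].+1)./2 * d ^+ (#[d].+1)./2.
  by rewrite -expgD addnn even_halfK ?expgS ?expg_order ?mulg1 //= od.
by rewrite (index2_memM iH) ?eqxx ?groupX.
Qed.

(** A subgroup of index 2 is determined by which of [x] and [y] it contains: for two distinct ones
    with the same pattern, the third subgroup [T] would contain all generators. Of the four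
    patterns, the one with both [x] and [y] inside is impossible. *)
Lemma card_index2_subgroups_le3 x y (D : {set gT}) :
    G \subset <<x |: (y |: D)>> -> x \in G -> y \in G -> D \subset G ->
    {in D, forall d, odd #[d]} ->
  #|index2_subgroups| <= 3.
Proof.
move=> genG Gx Gy sDG oD.
pose f (H : {group gT}) := (x \in H, y \in H).
have DH (H : {group gT}) : H \in index2_subgroups -> D \subset H.
  move=> iH; apply/subsetP=> d Dd.
  by apply: index2_odd_elt; rewrite ?oD // (subsetP sDG).
have inj_f : {in index2_subgroups &, injective f}.
  move=> H K iH iK [eqx eqy]; have [// | neqHK] := eqVneq H K.
  have [T DT [_ pT _]] := index2_third_cover iH iK neqHK.
  have /proper_subn/negP[] : T \proper G by apply: pT; rewrite !inE eqxx !orbT.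
  apply: subset_trans genG _; rewrite gen_subG DT.
  apply/subsetP=> g; rewrite !inE => /or3P[/eqP-> | /eqP-> | Dg].
  - by rewrite Gx eqx eqxx.
  - by rewrite Gy eqy eqxx.
  by rewrite (subsetP sDG) // !(subsetP (DH _ _) g).
rewrite -(card_in_imset inj_f).
apply: (@leq_trans #|[set~ (true, true)]|); last first.
  by rewrite cardsC1 card_prod card_bool.
apply/subset_leq_card/subsetP=> _ /imsetP[H iH ->]; rewrite !inE /f.
apply/eqP=> -[Hx Hy]; have /proper_subn/negP[] := index2_proper iH.
apply: subset_trans genG _; rewrite gen_subG.
by apply/subsetP=> g; rewrite !inE => /or3P[/eqP-> | /eqP-> | /(subsetP (DH H iH))].
Qed.

End Index2.

(** * The quaternion relations and the group they generate *)

Section QuaternionGens.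

Variables (gT : finGroupType) (x y : gT).
Hypotheses (ox : #[x] = 4) (y2 : y ^+ 2 = x ^+ 2) (xy : x ^ y = x^-1).

Lemma quaternion_gens_order : #[y] = 4.
Proof. by rewrite (@orderXprime _ 2 2) // y2 orderXdiv ?ox. Qed.

Lemma quaternion_gens_neqV : x^-1 != x.
Proof. by rewrite eq_invg_mul -[x * x]/(x ^+ 2) -order_dvdn ox. Qed.

(** [y ^ x = y * (x ^ y)^-1 * x = y * x ^+ 2 = y ^+ 3]. This makes the roles of [x] and [y]
    interchangeable. *)
Lemma quaternion_gens_conj : y ^ x = y^-1.
Proof.
have -> : y ^ x = y * (x ^ y)^-1 * x by rewrite /conjg !invMg invgK !mulgA mulgV mul1g.
rewrite xy invgK -mulgA -[x * x]y2.
by apply/eqP; rewrite eq_sym eq_invg_mul -!expgS -order_dvdn quaternion_gens_order.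
Qed.

Lemma quaternion_gens_notin : y \notin <[x]>.
Proof.
apply: contra quaternion_gens_neqV => /cycleP[i yi].
by rewrite -xy /conjg yi (commuteX i (commute_refl x)) mulKg.
Qed.

Lemma quaternion_gens_mul : <[x]> <*> <[y]> = <[x]> * <[y]>.
Proof. by rewrite norm_joinEr // norms_cycle xy groupV cycle_id. Qed.

(** By the presentation the group is an image of ['Q_8]. Its order is at least 8, since [<[x]> :&:
    <[y]>] is proper in [<[y]>] and hence has order at most 2. *)
Lemma quaternion_gens_isog : <[x]> <*> <[y]> \isog 'Q_8.
Proof.
have GrpQ := @Grp_quaternion 3 isT; rewrite isogEcard; apply/andP; split.
  rewrite -[8]/(2 ^ 3)%N GrpQ; apply/existsP; exists (x, y) => /=.
  have x4 : x ^+ (2 ^ 2) = 1 by rewrite -(expg_order x) ox.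
  by rewrite !xpair_eqE x4 y2 xy !eqxx.
rewrite (@card_quaternion 3) //= quaternion_gens_mul.
rewrite -(@leq_pmul2r #|<[x]> :&: <[y]>|) ?cardG_gt0 // -mul_cardG -!orderE.
rewrite ox quaternion_gens_order (@leq_pmul2l 8 _ 2) //.
have /proper_card : <[x]> :&: <[y]> \proper <[y]>.
  by rewrite properE subsetIr subsetI cycle_subG (negbTE quaternion_gens_notin).
have: #|<[x]> :&: <[y]>| %| #|<[y]>| by rewrite cardSg ?subsetIr.
by rewrite -orderE quaternion_gens_order; case: #|_| => [|[|[|[]]]].
Qed.

Lemma quaternion_gens_pgroup : 2.-group (<[x]> <*> <[y]>).
Proof.
rewrite quaternion_gens_mul pgroupM.
by rewrite /pgroup -!orderE ox quaternion_gens_order.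
Qed.

End QuaternionGens.

(** * Structure of Dedekind groups *)

Section DedekindStructure.

Variables (gT : finGroupType) (G : {group gT}).
Hypothesis dedG : forall H : {group gT}, H \subset G -> H <| G.

(** A nonabelian [K] would again be Dedekind, and so contain an element of order 4. *)
Lemma dedekind_odd_abelian (K : {group gT}) :
  K \subset G -> odd #|K| -> abelian K.
Proof.
move=> sKG; apply: contraLR => nabK.
have dedK (H : {group gT}) : H \subset K -> H <| K.
  by move=> sHK; apply: normalS (dedG (subset_trans sHK sKG)).
have [x [y [Kx _ ox _ _]]] := dedekind_nonabelian_quaternion_gens dedK nabK.
have := order_dvdG Kx; rewrite ox => d4; apply/negP=> oddK.
by have := dvdn_odd d4 oddK.
Qed.

(** Each constituent of an element generates a normal subgroup, which therefore lies in the
    corresponding core. *)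
Lemma dedekind_pcore_mul pi : 'O_pi(G) * 'O_pi^'(G) = G.
Proof.
apply/eqP; rewrite eqEsubset mul_subG ?pcore_sub //=.
have sub rho g : g \in G -> g.`_rho \in 'O_rho(G).
  move=> Gg; rewrite -cycle_subG pcore_max //; last first.
    by rewrite dedG // cycle_subG groupX.
  exact: p_elt_constt.
by apply/subsetP=> g Gg; rewrite -(consttC pi g) mem_mulg ?sub.
Qed.

(** Conjugates of [x] are elements of order 4 in [<[x]>], so the class of [x] is [x] and [x^-1], the
    latter being reached by [y]. *)
Lemma dedekind_cent1_index2 x y :
    x \in G -> y \in G -> #[x] = 4 -> x ^ y = x^-1 ->
  'C_G[x]%G \in index2_subgroups G.
Proof.
move=> Gx Gy ox xy; apply/index2_subgroupsP; split; first exact: subsetIl.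
rewrite index_cent1; have neqV := quaternion_gens_neqV ox.
have -> : x ^: G = [set x; x^-1].
  apply/eqP; rewrite eqEsubset; apply/andP; split; last first.
    by apply/subsetP=> _ /set2P[] ->; rewrite ?class_refl // -xy memJ_class.
  apply/subsetP=> _ /imsetP[g Gg ->].
  have := dedekind_conj_cycle dedG Gx Gg.
  case/cyclePmin=> i; rewrite ox => lti xg; have := orderJ x g.
  rewrite xg orderXgcd ox !inE; case: i lti {xg} => [|[|[|[|]]]] // _ _.
    by rewrite eqxx.
  by apply/orP; right; rewrite eq_sym eq_invg_mul -!expgS -order_dvdn ox.
by rewrite cards2 eq_sym neqV.
Qed.

Lemma dedekind_cent1_pair x y :
    x \in G -> y \in G -> #[x] = 4 -> y ^+ 2 = x ^+ 2 -> x ^ y = x^-1 ->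
  [/\ 'C_G[x]%G \in index2_subgroups G, 'C_G[y]%G \in index2_subgroups G,
      y \notin 'C_G[x] & x \notin 'C_G[y]].
Proof.
move=> Gx Gy ox y2 xy; have yx := quaternion_gens_conj ox y2 xy.
have ncxy : y \notin 'C[x].
  apply: contra (quaternion_gens_neqV ox) => /cent1P/commute_sym cxy.
  by rewrite -xy /conjg cxy mulKg.
split; last 1 first.
- by rewrite inE Gx cent1C.
- exact: dedekind_cent1_index2 Gx Gy ox xy.
- exact: dedekind_cent1_index2 Gy Gx (quaternion_gens_order ox y2) yx.
by rewrite inE Gy.
Qed.

(** [G / N] is a nontrivial 2-group, being an image of ['O_2(G)]. A maximal subgroup of it has index
    2 and is pulled back to [G]. *)
Lemma dedekind_index2_over (N : {group gT}) :
    N \proper G -> 'O_2^'(G) \subset N ->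
  exists2 H : {group gT}, H \in index2_subgroups G & N \subset H.
Proof.
move=> pNG sON; have [sNG nsGN] := andP pNG; have nNG := normal_norm (dedG sNG).
have p2 : 2.-group (G / N).
  have -> : G / N = 'O_2(G) / N.
    apply/eqP; rewrite eqEsubset andbC quotientS ?pcore_sub //=.
    rewrite -{1}(dedekind_pcore_mul 2) quotientMl ?(subset_trans (pcore_sub _ _)) //.
    by rewrite mulG_subG subxx /= quotientS1 // sub1G.
  exact/quotient_pgroup/pcore_pgroup.
have [GN1 | [M maxM _]] := maximal_exists (sub1G (G / N)).
  by rewrite -quotient_sub1 // -GN1 subxx in nsGN.
exists (coset N @*^-1 M)%G; last exact: (normal_sub (normal_cosetpre M)).
apply/index2_subgroupsP; split.
  rewrite sub_cosetpre_quo ?dedG //; exact: proper_sub (maxgroupp maxM).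
by rewrite -(quotientGK (dedG sNG)) index_cosetpre (p_maximal_index p2).
Qed.

End DedekindStructure.

(** * The two directions of the equivalence *)

Lemma dedekind_unique_cover_isog (gT : finGroupType) (G : {group gT}) :
    (forall H : {group gT}, H \subset G -> H <| G) -> ~~ abelian G ->
    (exists! P, three_proper_cover G P) ->
  G \isog setX 'Q_8 'O_2^'(G).
Proof.
move=> dedG nabG [P [_ uniqP]].
have [x [y [Gx Gy ox y2 xy]]] := dedekind_nonabelian_quaternion_gens dedG nabG.
set Q := (<[x]> <*> <[y]>)%G; set O := 'O_2^'(G)%G.
have sQG : Q \subset G by rewrite join_subG !cycle_subG Gx.
have sOG : O \subset G := pcore_sub _ _.
have [iA iB nAy nBx] := dedekind_cent1_pair dedG Gx Gy ox y2 xy.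
have Ax : x \in 'C_G[x] by rewrite inE Gx cent1id.
have neqAB : 'C_G[x]%G != 'C_G[y]%G.
  by apply: contraNneq nBx => /(congr1 val)/= <-.
have QO : Q <*> O = G.
  apply/eqP; apply: contraT => neqG.
  have pN : Q <*> O \proper G by rewrite properEneq neqG join_subG sQG.
  have [H iH sNH] := dedekind_index2_over dedG pN (joing_subr _ _).
  have [Hx Hy] : x \in H /\ y \in H.
    by split; apply: (subsetP sNH); rewrite mem_gen // inE mem_gen // inE cycle_id ?orbT.
  have [T DT covT] := index2_third_cover iA iB neqAB.
  have neqAH : 'C_G[x]%G != H by apply: contraNneq nAy => /(congr1 val)/= ->.
  have [T' _ covT'] := index2_third_cover iA iH neqAH.
  (* Uniqueness identifies the two covers, so [H] is ['C_G[y]] or [T]. Neither contains [x], but [H]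
     does. *)
  have: H \in [set 'C_G[x]%G; 'C_G[y]%G; T].
    by rewrite -(uniqP _ covT) (uniqP _ covT') !inE eqxx orbT.
  rewrite !inE eq_sym (negbTE neqAH) /= => /orP[] /eqP DH.
    by rewrite DH (negbTE nBx) in Hx.
  have: x \in gval T by rewrite -DH.
  by rewrite DT inE Ax (negbTE nBx) andbF.
have Q2 : 2.-group Q := quaternion_gens_pgroup ox y2 xy.
have O2 : 2^'.-group O := pcore_pgroup _ _.
have tiQO : Q :&: O = 1 by apply: coprime_TIg; apply: pnat_coprime Q2 O2.
(* Two normal subgroups with trivial intersection commute. *)
have cQO : O \subset 'C(Q).
  rewrite (sameP commG1P trivgP) -tiQO setIC commg_subI //.
    by rewrite subsetI subxx (subset_trans sOG) ?normal_norm ?dedG.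
  by rewrite subsetI subxx (subset_trans sQG) ?normal_norm ?dedG.
have defG : Q \x O = G by rewrite dprodEY.
apply: isog_dprod defG (setX_dprod _ _) _ _; last exact: isog_set1X.
exact: isog_trans (quaternion_gens_isog ox y2 xy) (isog_setX1 _ _).
Qed.

(** Two generators of ['Q_8] and the factor [setX 1 A], carried over by [f], form a generating set
    as in [card_index2_subgroups_le3]. *)
Lemma isog_quaternion_odd_card_index2 (gT aT : finGroupType) (G : {group gT})
    (A : {group aT}) :
  odd #|A| -> G \isog setX 'Q_8 A -> #|index2_subgroups G| <= 3.
Proof.
move=> oddA; rewrite isog_sym => /isogP[f injf imf].
have /existsP[[x y] /= /eqP[Qxy _ _ _]] := isoGrp_hom (@Grp_quaternion 3 isT).
set x' := pairg1 aT x; set y' := pairg1 aT y.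
have sub1A u : u \in setX 1 A -> u \in setX 'Q_8 A.
  by case: u => q a /setXP[_ Aa]; rewrite inE in_setT.
have Lq (q : 'Q_8) : pairg1 aT q \in setX 'Q_8 A by rewrite !inE /=.
apply: (@card_index2_subgroups_le3 _ _ (f x') (f y') (f @* setX 1 A)).
- have sS : [set x'; y'] :|: setX 1 A \subset setX 'Q_8 A.
    by rewrite !subUset !sub1set !Lq; apply/subsetP=> u /sub1A.
  have -> : f x' |: (f y' |: f @* setX 1 A) = f @* ([set x'; y'] :|: setX 1 A).
    by rewrite !morphimU !morphim_set1 ?Lq // setUA.
  rewrite -imf -morphim_gen // morphimS //.
  apply/subsetP=> -[q a] /setXP[_ Aa].
  have -> : (q, a) = pairg1 aT q * pair1g _ a by congr (_, _); rewrite /= ?mulg1 ?mul1g.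
  rewrite groupM //; last by rewrite mem_gen // !inE /= Aa eqxx orbT.
  have: pairg1 aT q \in pairg1 aT @* <<[set x] :|: [set y]>>.
    rewrite mem_morphim ?inE // -joingE -joing_idl -joing_idr.
    by rewrite -/(cycle x) -/(cycle y) Qxy inE.
  rewrite morphim_gen ?subsetT // morphimU !morphim_set1 ?inE //.
  by apply/subsetP/genS/subsetUl.
- by rewrite -imf mem_morphim ?Lq.
- by rewrite -imf mem_morphim ?Lq.
- by rewrite -imf morphimS //; apply/subsetP=> u /sub1A.
move=> d Dd; apply: dvdn_odd oddA; have := order_dvdG Dd.
rewrite card_injm ?cardsX ?cards1 ?mul1n //.
by apply/subsetP=> u /sub1A.
Qed.

Theorem corollaryF (gT : finGroupType) (G : {group gT})
    (hG : hamiltonian G) :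
  (exists! P : {set {group gT}}, three_proper_cover G P) <->
  (exists (aT : finGroupType) (A : {group aT}),
     [/\ abelian A, odd #|A| & G \isog setX 'Q_8 A]).
Proof.
have [/negP nabG dedG] := hG; split=> [uniqP | [aT [A [_ oddA isoG]]]].
  have oddO : odd #|'O_2^'(G)| by rewrite odd_2'nat; apply: pcore_pgroup.
  exists gT, 'O_2^'(G)%G; split=> //; last exact: dedekind_unique_cover_isog.
  exact: (dedekind_odd_abelian dedG (pcore_sub 2^' G) oddO).
apply: three_proper_cover_unique (isog_quaternion_odd_card_index2 oddA isoG).
(* What remains is the existence of a cover, which the two centralizers provide. *)
have [x [y [Gx Gy ox y2 xy]]] := dedekind_nonabelian_quaternion_gens dedG nabG.
have [iA iB _ nBx] := dedekind_cent1_pair dedG Gx Gy ox y2 xy.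
have neqAB : 'C_G[x]%G != 'C_G[y]%G.
  by apply: contraNneq nBx => /(congr1 val)/= <-; rewrite inE Gx cent1id.
have [T _ covT] := index2_third_cover iA iB neqAB.
by exists [set 'C_G[x]%G; 'C_G[y]%G; T].
Qed.
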